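(* Let $S(\mathbf{G}(V,E),\mathbf{\Sigma})$ be a constrained switching system with $\mathbf{\Sigma}\subset\mathbb{R}^{n\times n}$. Suppose $\gamma_*=\gamma_*(S)$ is attained by symmetric matrices $\{Q_v\succ0: v\in V\}$, i.e. $\gamma_*^2Q_v-A_\sigma^\top Q_wA_\sigma\succeq0$ for all $(v,w,\sigma)\in E$, and let $\mathcal{M}=\{|\cdot|_v\}$ with $|x|_v=(x^\top Q_vx)^{1/2}$ be the corresponding quadratic multinorm, of value $\gamma_*$. If the set of edges $$E'=\{(v,w,\sigma)\in E : \lambda_{\min}(\gamma_*^2Q_v-A_\sigma^\top Q_wA_\sigma)=0\}$$ forms a simple cycle $c$ in $\mathbf{G}$, then $\mathcal{M}$ is extremal (its value equals $\hat\rho(S)$), and $\hat\rho(S)=\rho(A_c)^{1/T}$, where $T$ is the length of $c$.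
   Context: An automaton $\mathbf{G}(V,E)$ is a strongly connected directed graph with finite node set $V$ and finite edge set $E$ of labelled edges $(v,w,\sigma)$, $\sigma$ indexing a matrix $A_\sigma\in\mathbf{\Sigma}$. A path is a sequence of consecutive edges; for a path with labels $\sigma(1),\dots,\sigma(T)$, $A_p=A_{\sigma(T)}\cdots A_{\sigma(1)}$. A cycle is a path whose source and destination coincide; a cycle is simple if for every node $v$ it visits there is no partition of the cycle into two cycles on $v$. A label sequence is accepted if it is the label sequence of some path (no prescribed initial/final node). The CJSR is $\hat\rho(S)=\lim_{t\to\infty}\max\{\|A_{\sigma(t-1)}\cdots A_{\sigma(0)}\|^{1/t} : \sigma(0),\dots,\sigma(t-1)\text{ accepted}\}$. $\gamma_*(S)$ is the infimum of $\gamma$ such that there exist symmetric $Q_v\succ0$ ($v\in V$) with $\gamma^2Q_v-A_\sigma^\top Q_wA_\sigma\succeq0$ for all $(v,w,\sigma)\in E$. A multinorm is a family of vector norms $\{|\cdot|_v:v\in V\}$; its value is $\min\{\gamma:|A_\sigma x|_w\le\gamma|x|_v\ \forall x,\ \forall(v,w,\sigma)\in E\}$, and it is extremal if its value equals $\hat\rho(S)$. $\rho(\cdot)$ denotes the spectral radius and $\lambda_{\min}$ the smallest eigenvalue of a symmetric matrix. *)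

(* Defs.v *)
From HB Require Import structures.
From mathcomp Require Import all_boot all_order all_algebra.
From mathcomp Require Import all_classical all_reals all_analysis.
From mathcomp Require Import complex.
Set Implicit Arguments. Unset Strict Implicit. Unset Printing Implicit Defensive.
Import Order.TTheory GRing.Theory Num.Theory.
Import numFieldNormedType.Exports.
Local Open Scope classical_set_scope.
Local Open Scope ring_scope.

Section CSS.
Variables (R : realType) (n : nat) (V L : finType).

Definition edge := (V * V * L)%type.
Definition src (e : edge) : V := e.1.1.
Definition dst (e : edge) : V := e.1.2.
Definition lab (e : edge) : L := e.2.

Fixpoint chained (p : seq edge) : bool :=
  match p with
  | e :: ((e' :: _) as q) => (dst e == src e') && chained q
  | _ => true
  end.

Definition is_path (E : {set edge}) (p : seq edge) : bool :=
  [&& p != [::], all (fun e => e \in E) p & chained p].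

Definition path_src (p : seq edge) : option V :=
  if p is e :: _ then Some (src e) else None.
Definition path_dst (p : seq edge) : option V :=
  if p is e :: _ then Some (dst (last e p)) else None.

Definition strongly_connected (E : {set edge}) : Prop :=
  forall v w : V, v <> w ->
    exists p, is_path E p /\ path_src p = Some v /\ path_dst p = Some w.

Definition is_cycle (E : {set edge}) (c : seq edge) : Prop :=
  is_path E c /\ path_src c = path_dst c.

Definition cycle_on (E : {set edge}) (v : V) (c : seq edge) : Prop :=
  is_cycle E c /\ path_src c = Some v.

Definition simple_cycle (E : {set edge}) (c : seq edge) : Prop :=
  is_cycle E c /\
  forall v : V, v \in map src c ->
    ~ exists k c1 c2, rot k c = c1 ++ c2 /\ cycle_on E v c1 /\ cycle_on E v c2.

Definition accepted (E : {set edge}) (s : seq L) : Prop :=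
  exists p, is_path E p /\ map lab p = s.

Definition prodA (A : L -> 'M[R]_n) (s : seq L) : 'M[R]_n :=
  foldl (fun M sg => A sg *m M) 1%:M s.

(* constrained joint spectral radius; the matrix norm is the (max-entry)
   norm of MathComp-Analysis; the limit does not depend on the norm. *)
Definition cjsr (E : {set edge}) (A : L -> 'M[R]_n) : R :=
  lim ((fun t : nat =>
          sup [set `|prodA A s| `^ (t%:R^-1) | s in
                 [set s | accepted E s /\ size s = t]]) @ \oo).

Definition posdef (Q : 'M[R]_n) : Prop :=
  Q^T = Q /\ forall x : 'cV[R]_n, x != 0 -> 0 < (x^T *m Q *m x) 0 0.
Definition psd (M : 'M[R]_n) : Prop :=
  M^T = M /\ forall x : 'cV[R]_n, 0 <= (x^T *m M *m x) 0 0.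

Definition lmi_mx (A : L -> 'M[R]_n) (Q : V -> 'M[R]_n) (g : R) (e : edge) :=
  g ^+ 2 *: Q (src e) - (A (lab e))^T *m Q (dst e) *m A (lab e).

Definition gamma_star (E : {set edge}) (A : L -> 'M[R]_n) : R :=
  inf [set g : R | 0 <= g /\ exists Q : V -> 'M[R]_n,
         (forall v, posdef (Q v)) /\ forall e, e \in E -> psd (lmi_mx A Q g e)].

Definition lambda_min (M : 'M[R]_n) : R := inf [set x : R | eigenvalue M x].

Definition spectral_radius (M : 'M[R]_n) : R :=
  sup [set Num.sqrt (complex.Re l ^+ 2 + complex.Im l ^+ 2) | l in [set l : R[i] |
         eigenvalue (map_mx (real_complex R) M) l]].

Definition quadnorm (Q : V -> 'M[R]_n) (v : V) (x : 'cV[R]_n) : R :=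
  Num.sqrt ((x^T *m Q v *m x) 0 0).

Definition multinorm_value (E : {set edge}) (A : L -> 'M[R]_n)
    (N : V -> 'cV[R]_n -> R) : R :=
  inf [set g : R | 0 <= g /\ forall e, e \in E -> forall x : 'cV[R]_n,
         N (dst e) (A (lab e) *m x) <= g * N (src e) x].

Definition extremal (E : {set edge}) (A : L -> 'M[R]_n)
    (N : V -> 'cV[R]_n -> R) : Prop :=
  multinorm_value E A N = cjsr E A.

End CSS.

(* Main.v *)
Require Import Defs.
From HB Require Import structures.
From mathcomp Require Import all_boot all_order all_algebra.
From mathcomp Require Import all_classical all_reals all_analysis.
From mathcomp Require Import complex.
From mathcomp Require Import ring lra zify.
Set Implicit Arguments.
Unset Strict Implicit.
Unset Printing Implicit Defensive.
Import Order.TTheory GRing.Theory Num.Theory.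
Import numFieldNormedType.Exports.
Local Open Scope ring_scope.

(* Write g for gamma_*.  A product along a path of length t has norm at most
   K g^t.  Conversely, for every N some product of length N along the cycle must
   have norm at least g^N / K: otherwise the truncated Lyapunov sums
   P_i = sum_(m < N) g^(-2m) M_(i,m)^T M_(i,m), with M_(i,m) the product of m
   matrices along the cycle from its i-th node, satisfy the strict inequality on
   the edges of the cycle.  They are well defined on nodes because a simple cycle
   visits a node once, and all other edges are strict for Q, so D Q + P is
   strictly feasible for a large D, which allows g to be lowered.  This squeezes
   the CJSR to g, and Gelfand's formula turns the lower bound, taken along
   multiples of the period, into rho(A_c) = g^T. *)

(** * Quadratic forms *)

Definition qform (R : realType) (n : nat) (M : 'M[R]_n) (x : 'cV[R]_n) : R :=
  (x^T *m M *m x) 0 0.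

Lemma qformD (R : realType) (n : nat) (M N : 'M[R]_n) x :
  qform (M + N) x = qform M x + qform N x.
Proof. by rewrite /qform mulmxDr mulmxDl mxE. Qed.

Lemma qformZ (R : realType) (n : nat) a (M : 'M[R]_n) x :
  qform (a *: M) x = a * qform M x.
Proof. by rewrite /qform -scalemxAr -scalemxAl mxE. Qed.

Lemma qformN (R : realType) (n : nat) (M : 'M[R]_n) x :
  qform (- M) x = - qform M x.
Proof. by rewrite -scaleN1r qformZ mulN1r. Qed.

Lemma qform_congr (R : realType) (n : nat) (M N : 'M[R]_n) x :
  qform (N^T *m M *m N) x = qform M (N *m x).
Proof. by rewrite /qform trmx_mul !mulmxA. Qed.

Lemma qform_shift (R : realType) (n : nat) (M : 'M[R]_n) (t : R) x y :
  M^T = M ->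
  qform M (x + t *: y) =
  qform M x + 2 * t * (x^T *m M *m y) 0 0 + t ^+ 2 * qform M y.
Proof.
move=> symM.
have sym : (y^T *m M *m x) 0 0 = (x^T *m M *m y) 0 0.
  by rewrite -[in LHS](trmxK (y^T *m M *m x)) mxE !trmx_mul trmxK symM mulmxA.
rewrite /qform; have -> : (x + t *: y)^T = x^T + t *: y^T by rewrite linearD linearZ.
rewrite mulmxDl mulmxDr !mulmxDl -!scalemxAr -!scalemxAl.
by move: sym; rewrite !mxE => ->; ring.
Qed.

(** The form of [M] along the line x + t y is a polynomial in t, at most quadratic, that is
    nonnegative everywhere. *)
Lemma psd_CauchySchwarz (R : realType) (n : nat) (M : 'M[R]_n) x y :
  psd M -> ((x^T *m M *m y) 0 0) ^+ 2 <= qform M x * qform M y.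
Proof.
move=> [symM M0].
set b := (x^T *m M *m y) 0 0; set a := qform M x; set d := qform M y.
have a0 : 0 <= a by exact: M0.
have d0 : 0 <= d by exact: M0.
have h t : 0 <= a + 2 * t * b + t ^+ 2 * d.
  by rewrite -qform_shift//; exact: M0.
have [d00|dN0] := eqVneq d 0.
  have [->|bN0] := eqVneq b 0; first by rewrite expr0n mulr_ge0.
  (* For d = 0 the polynomial is affine, and this t would give it the value -1. *)
  have := h (- (a + 1) / (2 * b)).
  have -> : 2 * (- (a + 1) / (2 * b)) * b = - (a + 1) by field.
  by rewrite d00; lra.
(* For d > 0 this is the minimiser. *)
have := h (- b / d).
have -> : a + 2 * (- b / d) * b + (- b / d) ^+ 2 * d = (a * d - b ^+ 2) / d by field.
by rewrite pmulr_lge0 ?invr_gt0 ?lt_neqAle ?d0 1?eq_sym ?dN0// subr_ge0.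
Qed.

Lemma posdef_psd (R : realType) (n : nat) (M : 'M[R]_n) : posdef M -> psd M.
Proof.
move=> [symM M0]; split=> // x; have [->|/M0/ltW//] := eqVneq x 0.
by rewrite trmx0 !mul0mx mxE.
Qed.

(** Cauchy-Schwarz against each basis vector makes every entry of the row vanish. *)
Lemma psd_isotropic (R : realType) (n : nat) (M : 'M[R]_n) x :
  psd M -> qform M x = 0 -> x^T *m M = 0.
Proof.
move=> psdM x0; apply/rowP => i; rewrite [RHS]mxE.
have := psd_CauchySchwarz x (delta_mx i 0) psdM.
rewrite x0 mul0r real_exprn_even_le0 ?num_real//= => /eqP.
by rewrite -colE mxE.
Qed.

Lemma qform1 (R : realType) (n : nat) (x : 'cV[R]_n) :
  qform 1%:M x = \sum_i x i 0 ^+ 2.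
Proof.
by rewrite /qform mulmx1 mxE; apply: eq_bigr => i _; rewrite mxE expr2.
Qed.

Lemma qform1_gt0 (R : realType) (n : nat) (x : 'cV[R]_n) :
  x != 0 -> 0 < qform 1%:M x.
Proof.
move=> xN0; rewrite qform1 lt_neqAle sumr_ge0 ?andbT; last first.
  by move=> *; rewrite sqr_ge0.
apply: contra xN0 => /eqP/esym/psumr_eq0P h; apply/eqP/colP => i.
by apply/eqP; rewrite mxE -sqrf_eq0; apply/eqP/h => // j _; rewrite sqr_ge0.
Qed.

(** A nonzero isotropic vector is an eigenvector for 0; as all eigenvalues are nonnegative, the
    infimum [lambda_min] would be 0. This makes the edges outside the critical set strict. *)
Lemma psd_posdef (R : realType) (n : nat) (M : 'M[R]_n) :
  psd M -> lambda_min M != 0 -> posdef M.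
Proof.
move=> psdM lN0; split=> [|x xN0]; first by case: psdM.
have [symM M0] := psdM.
rewrite lt_neqAle M0 andbT; apply: contra lN0 => /eqP/esym qx0.
have ev0 : eigenvalue M 0.
  apply/eigenvalueP; exists x^T; last by rewrite trmx_eq0.
  by rewrite scale0r; exact: psd_isotropic.
have ev_ge0 l : eigenvalue M l -> 0 <= l.
  move=> /eigenvalueP[v vM vN0].
  have := M0 v^T; rewrite trmxK vM -scalemxAl mxE pmulr_lge0//.
  have vT0 : v^T != 0 by rewrite trmx_eq0.
  by have := qform1_gt0 vT0; rewrite /qform mulmx1 trmxK.
apply/eqP/le_anti/andP; split.
  by apply: ge_inf => //; exists 0.
by apply: lb_le_inf => //; exists 0.
Qed.

Lemma posdef1 (R : realType) (n : nat) : posdef (1%:M : 'M[R]_n).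
Proof. by split; [rewrite trmx1|exact: qform1_gt0]. Qed.

Lemma qform1_coord (R : realType) (n : nat) (x : 'cV[R]_n) i :
  x i 0 ^+ 2 <= qform 1%:M x.
Proof.
rewrite qform1 (bigD1 i)//= lerDl; apply: sumr_ge0 => *; exact: sqr_ge0.
Qed.

Lemma qform_le_norm (R : realType) (n : nat) (B : 'M[R]_n) x :
  qform B x <= (\sum_i \sum_j `|B i j|) * qform 1%:M x.
Proof.
have -> : qform B x = \sum_i \sum_j B i j * (x i 0 * x j 0).
  rewrite /qform -mulmxA mxE; apply: eq_bigr => i _.
  rewrite !mxE mulr_sumr; apply: eq_bigr => j _; ring.
rewrite mulr_suml; apply: ler_sum => i _; rewrite mulr_suml.
apply: ler_sum => j _; apply: le_trans (ler_norm _) _; rewrite normrM.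
apply: ler_wpM2l => //; rewrite ler_norml.
(* From (u - v)^2 and (u + v)^2 nonnegative, |u v| <= (u^2 + v^2) / 2 <= s. *)
have := qform1_coord x i; have := qform1_coord x j.
have := sqr_ge0 (x i 0 - x j 0); have := sqr_ge0 (x i 0 + x j 0).
move: (qform _ _) => s; move: (x i 0) (x j 0) => u v; nra.
Qed.

(* By Cauchy-Schwarz for [M], each coordinate of [x] satisfies
   x_i^2 = <M^-1 e_i, x>_M^2 <= |M^-1 e_i|_M^2 |x|_M^2. *)
Lemma posdef_coercive (R : realType) (n : nat) (M : 'M[R]_n) :
  posdef M -> exists2 C, 0 <= C & forall x, qform 1%:M x <= C * qform M x.
Proof.
move=> pM; have [symM M0] := pM.
have uM : M \in unitmx.
  rewrite -row_free_unit -kermx_eq0; apply/eqP/row_matrixP => i.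
  rewrite row0; apply/eqP/negP => /negP vN0.
  have := M0 (row i (kermx M))^T; rewrite trmx_eq0 => /(_ vN0).
  by rewrite trmxK -row_mul mulmx_ker row0 mul0mx mxE ltxx.
pose y i := invmx M *m delta_mx i 0 : 'cV[R]_n.
exists (\sum_i qform M (y i)).
  by apply: sumr_ge0 => i _; case: (posdef_psd pM) => _; exact.
move=> x; rewrite qform1 mulr_suml; apply: ler_sum => i _.
have := psd_CauchySchwarz (y i) x (posdef_psd pM); congr (_ ^+ 2 <= _).
rewrite /y trmx_mul trmx_inv symM -mulmxA -mulmxA mulKmx//.
by rewrite trmx_delta -rowE mxE.
Qed.

Lemma posdef_dominates (R : realType) (n : nat) (M B : 'M[R]_n) :
  posdef M ->
  exists C, forall D, C <= D -> forall x, qform B x <= D * qform M x.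
Proof.
move=> pM; have [C C0 hC] := posdef_coercive pM.
exists ((\sum_i \sum_j `|B i j|) * C) => D CD x.
apply: le_trans (qform_le_norm _ _) _.
have M0 : 0 <= qform M x by case: (posdef_psd pM) => _; exact.
apply: le_trans (ler_wpM2r M0 CD); rewrite -mulrA ler_wpM2l//.
by apply: sumr_ge0 => i _; apply: sumr_ge0.
Qed.

(** Thresholds are merged by summing absolute values, which also covers an empty index type. This is
    why bounds are stated for all D beyond some C. *)
Lemma fin_uniform_bound (R : realType) (I : finType) (P : I -> R -> Prop) :
  (forall i, exists C, forall D, C <= D -> P i D) ->
  exists C, forall D, C <= D -> forall i, P i D.
Proof.
move=> /choice[f hf]; exists (\sum_i `|f i|) => D fD i; apply: hf.
apply: le_trans fD; rewrite (bigD1 i)//=; apply: le_trans (ler_norm _) _.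
by rewrite lerDl sumr_ge0.
Qed.

(** * Matrix norms and powers *)

Lemma mx_norm_entry (R : realType) (m n : nat) (M : 'M[R]_(m, n)) i j :
  `|M i j| <= `|M|.
Proof.
by rewrite [leRHS]/Num.norm /= mx_normrE (le_bigmax _ (fun ij => `|M ij.1 ij.2|) (i, j)).
Qed.

Lemma mx_norm_le (R : realType) (m n : nat) (M : 'M[R]_(m, n)) C :
  0 <= C -> (forall i j, `|M i j| <= C) -> `|M| <= C.
Proof.
by move=> C0 h; rewrite [leLHS]/Num.norm /= mx_normrE; apply: bigmax_le.
Qed.

Lemma mx_norm_mulmx (R : realType) (m n p : nat) (M : 'M[R]_(m, n))
  (N : 'M[R]_(n, p)) : `|M *m N| <= n%:R * (`|M| * `|N|).
Proof.
apply: mx_norm_le => [|i j]; first by rewrite !mulr_ge0.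
rewrite mxE; apply: le_trans (ler_norm_sum _ _ _) _.
rewrite mulr_natl -[X in _ *+ X]card_ord -sumr_const; apply: ler_sum => k _.
by rewrite normrM ler_pM// mx_norm_entry.
Qed.

(** If b < a, then C (b/a)^k would tend to 0 while staying at least 1. The lemma serves to discard
    constants when comparing growth rates. *)
Lemma geometric_domination (R : realType) (a b C : R) :
  0 <= a -> 0 <= b -> (forall k : nat, a ^+ k <= C * b ^+ k) -> a <= b.
Proof.
move=> a0 b0 h; rewrite leNgt; apply/negP => ba.
have a_gt0 : 0 < a by exact: le_lt_trans ba.
have lim0 : (C * (b / a) ^+ k @[k --> \oo] --> C * 0)%classic.
  apply: cvgMr; apply: cvg_expr.
  by rewrite ger0_norm ?divr_ge0// ltr_pdivrMr// mul1r.
suff : 1 <= C * 0 by rewrite mulr0 ler10.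
rewrite -(cvg_lim _ lim0)//; apply: limr_ge; first exact: cvgP lim0.
near=> k; rewrite expr_div_n mulrA ler_pdivlMr ?exprn_gt0// mul1r; exact: h.
Unshelve. all: by end_near.
Qed.

(** * Complex moduli and the growth of matrix powers *)

Lemma normc_ge0 (R : realType) (z : R[i]) : 0 <= Normc.normc z.
Proof. by case: z => x y; exact: sqrtr_ge0. Qed.

Lemma normcR (R : realType) (x : R) : Normc.normc (x%:C)%C = `|x|.
Proof. by rewrite /= expr0n addr0 sqrtr_sqr. Qed.

Lemma normc_sqrt (R : realType) (z : R[i]) :
  Num.sqrt (complex.Re z ^+ 2 + complex.Im z ^+ 2) = Normc.normc z.
Proof. by case: z. Qed.

Lemma normcX (R : realType) (z : R[i]) k :
  Normc.normc (z ^+ k) = Normc.normc z ^+ k.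
Proof.
elim: k => [|k IH]; first by rewrite !expr0 Normc.normc1.
by rewrite !exprS Normc.normcM IH.
Qed.

Lemma normc_sum (R : realType) (I : finType) (F : I -> R[i]) :
  Normc.normc (\sum_i F i) <= \sum_i Normc.normc (F i).
Proof.
apply: (big_ind2 (fun z (x : R) => Normc.normc z <= x)) => //.
  by rewrite Normc.normc0.
by move=> z x w y zx wy; apply: le_trans (le_normcD _ _) (lerD zx wy).
Qed.

Lemma affine_recurrence_bound (R : realType) (u : nat -> R[i]) (l : R[i]) s C :
  0 <= C -> Normc.normc l < s ->
  (forall k, Normc.normc (u k.+1 - l * u k) <= C * s ^+ k) ->
  exists2 D, 0 <= D & forall k, Normc.normc (u k) <= D * s ^+ k.
Proof.
move=> C0 ls h; have s0 : 0 <= s by exact: le_trans (normc_ge0 l) (ltW ls).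
have sl : 0 < s - Normc.normc l by rewrite subr_gt0.
(* The first term settles k = 0; the second gives C <= D (s - |l|), which closes the induction. *)
exists (Normc.normc (u 0) + C / (s - Normc.normc l)).
  by rewrite addr_ge0 ?normc_ge0// divr_ge0// ltW.
set D := _ + _ / _; elim=> [|k IH].
  by rewrite expr0 mulr1 lerDl divr_ge0// ltW.
have -> : u k.+1 = (u k.+1 - l * u k) + l * u k by rewrite subrK.
apply: le_trans (le_normcD _ _) _; rewrite Normc.normcM.
have CD : C <= D * (s - Normc.normc l).
  rewrite /D mulrDl divfK ?gt_eqF// lerDr mulr_ge0 ?normc_ge0//; exact: ltW.
have := h k; move: IH CD (normc_ge0 l) (exprn_ge0 k s0); rewrite exprS.
move: (Normc.normc (_ - _)) (Normc.normc (u k)) (Normc.normc l) (s ^+ k) => a b c d.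
nra.
Qed.

(* Gelfand's upper bound without a Jordan form: each root [l] of an
   annihilating polynomial contributes one affine scalar recurrence
   [u_(k+1) = l u_k + v_k] for the entries [u_k] of [A^k B]. *)
Lemma power_bound_roots (R : realType) (n : nat) (A : 'M[R[i]]_n.+1) s
  (rs : seq R[i]) (B : 'M[R[i]]_n.+1) i j :
  0 <= s -> {in rs, forall l, Normc.normc l < s} ->
  horner_mx A (\prod_(l <- rs) ('X - l%:P)) * B = 0 ->
  exists2 C, 0 <= C & forall k, Normc.normc ((A ^+ k * B) i j) <= C * s ^+ k.
Proof.
move=> s0; elim: rs B => [|l rs IH] B rs_lt.
  rewrite big_nil rmorph1 mul1r => ->; exists 0 => // k.
  by rewrite mulr0 mxE Normc.normc0 mul0r.
rewrite big_cons mulrC rmorphM -mulrA => /IH[x xrs|C C0 hC].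
  by apply: rs_lt; rewrite inE xrs orbT.
apply: (@affine_recurrence_bound _ _ l _ C) => // [|k].
  by apply: rs_lt; rewrite inE eqxx.
have := hC k; congr (Normc.normc _ <= _).
rewrite rmorphB /= horner_mx_X horner_mx_C mulrBl mulrBr !mulrA -exprSr.
have -> : A ^+ k * l%:M * B = l *: (A ^+ k * B).
  by rewrite -[_ * l%:M]/(_ *m _) mul_mx_scalar -scalerAl.
by rewrite !mxE.
Qed.

(** Over the complex numbers the characteristic polynomial splits, its roots are eigenvalues, and it
    annihilates the matrix by Cayley-Hamilton. *)
Lemma eigenvalue_bound_power (R : realType) (n : nat) (M : 'M[R]_n.+1) s :
  0 <= s ->
  (forall l, eigenvalue (map_mx (real_complex R) M) l -> Normc.normc l < s) ->
  exists2 C, 0 <= C & forall k, `|M ^+ k| <= C * s ^+ k.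
Proof.
move=> s0 ev_lt; set A := map_mx _ M in ev_lt.
have [rs chE] := closed_field_poly_normal (char_poly A).
rewrite (monicP (char_poly_monic A)) scale1r in chE.
have rs_lt : {in rs, forall l, Normc.normc l < s}.
  by move=> l lrs; apply: ev_lt; rewrite eigenvalue_root_char chE root_prod_XsubC.
have h (ij : 'I_n.+1 * 'I_n.+1) : exists C, 0 <= C /\
    forall k, `|(M ^+ k) ij.1 ij.2| <= C * s ^+ k.
  have ann : horner_mx A (\prod_(l <- rs) ('X - l%:P)) * 1 = 0.
    by rewrite -chE mulr1 Cayley_Hamilton.
  have [C C0 hC] := power_bound_roots ij.1 ij.2 s0 rs_lt ann.
  exists C; split=> // k; have := hC k.
  by rewrite mulr1 -rmorphXn mxE normcR.
have [f hf] := boolp.choice h.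
have f0 ij : 0 <= f ij by case: (hf ij).
exists (\sum_ij f ij); first by rewrite sumr_ge0.
move=> k; apply: mx_norm_le => [|i j].
  by rewrite mulr_ge0 ?exprn_ge0// sumr_ge0.
have [_ /(_ k) /= hk] := hf (i, j); apply: le_trans hk _.
by rewrite ler_wpM2r ?exprn_ge0// (bigD1 (i, j))//= lerDl sumr_ge0.
Qed.

(** A left eigenvector v gives v M^k = l^k v; comparing one nonzero coordinate bounds |l|^k by a
    constant times s^k. *)
Lemma eigenvalue_le_growth (R : realType) (n : nat) (M : 'M[R]_n) C s l :
  0 <= s -> (forall k, `|iter k (mulmx M) 1%:M| <= C * s ^+ k) ->
  eigenvalue (map_mx (real_complex R) M) l -> Normc.normc l <= s.
Proof.
move=> s0 hC /eigenvalueP[v vM vN0].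
have vMk k : v *m map_mx (real_complex R) (iter k (mulmx M) 1%:M) = l ^+ k *: v.
  elim: k => [|k IH]; first by rewrite map_mx1 mulmx1 expr0 scale1r.
  by rewrite iterS map_mxM mulmxA vM -scalemxAl IH scalerA exprS.
have [j vj] : exists j, v 0 j != 0.
  apply/existsP; apply: contraR vN0; rewrite negb_exists => /forallP h.
  by apply/eqP/rowP => j; rewrite mxE; apply/eqP; move: (h j); rewrite negbK.
have nvj : 0 < Normc.normc (v 0 j).
  rewrite lt_neqAle normc_ge0 andbT eq_sym; apply: contra vj => /eqP.
  by move/Normc.eq0_normc ->.
apply: (@geometric_domination _ _ _
  ((\sum_i Normc.normc (v 0 i)) * C / Normc.normc (v 0 j))) => //.
  exact: normc_ge0.
move=> k; rewrite mulrAC ler_pdivlMr// -normcX -Normc.normcM.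
have -> : l ^+ k * v 0 j = (v *m map_mx (real_complex R) (iter k (mulmx M) 1%:M)) 0 j.
  by rewrite vMk mxE.
rewrite mxE; apply: le_trans (normc_sum _) _; rewrite -mulrA mulr_suml.
apply: ler_sum => i _; rewrite Normc.normcM ler_wpM2l ?normc_ge0// mxE normcR.
exact: le_trans (mx_norm_entry _ _ _) (hC k).
Qed.

(** * Paths and windows of a cycle *)

Lemma prodA_cat (R : realType) (n : nat) (L : finType) (A : L -> 'M[R]_n) s t :
  prodA A (s ++ t) = prodA A t *m prodA A s.
Proof.
elim/last_ind: t => [|t a IH]; first by rewrite cats0 mul1mx.
by rewrite /prodA -rcons_cat !foldl_rcons -/(prodA A _) IH mulmxA.
Qed.

Lemma prodA_cons (R : realType) (n : nat) (L : finType) (A : L -> 'M[R]_n) a s :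
  prodA A (a :: s) = prodA A s *m A a.
Proof. by rewrite -cat1s prodA_cat /prodA /= mulmx1. Qed.

(** Each matrix inequality is a one-step estimate between the forms at the two ends of an edge;
    chaining multiplies the factors g^2. *)
Lemma path_qform_bound (R : realType) (n : nat) (V L : finType)
  (E : {set edge V L}) (A : L -> 'M[R]_n) (Q : V -> 'M[R]_n) g e p :
  (forall e, e \in E -> psd (lmi_mx A Q g e)) ->
  is_path E (e :: p) -> forall x,
  qform (Q (dst (last e p))) (prodA A (map (@lab V L) (e :: p)) *m x) <=
  g ^+ 2 ^+ (size p).+1 * qform (Q (src e)) x.
Proof.
move=> hlmi; have step f y : f \in E ->
    qform (Q (dst f)) (A (lab f) *m y) <= g ^+ 2 * qform (Q (src f)) y.
  move=> /hlmi[_ /(_ y)]; rewrite -/(qform _ y) /lmi_mx qformD qformN qformZ.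
  by rewrite qform_congr subr_ge0.
elim: p e => [|f p IH] e /and3P[_ /= /andP[eE allE] ch] x.
  by rewrite /prodA /= mulmx1 expr1; exact: step.
move: ch => /andP[/eqP ef ch].
rewrite -map_cons prodA_cons -mulmxA.
have pathf : is_path E (f :: p) by apply/and3P.
apply: le_trans (IH f pathf _) _; rewrite [in leRHS]exprSr -mulrA.
apply: ler_wpM2l; first by rewrite exprn_ge0// sqr_ge0.
by rewrite -ef; exact: step.
Qed.

(** Periodic extension of [c] to all indices; [e0] is the default of [nth], returned when [c] is
    empty. *)
Definition cyc_edge (V L : finType) (e0 : edge V L) (c : seq (edge V L)) i :=
  nth e0 c (i %% size c).

(** A window may wrap around several times, so a cycle supplies paths of every positive length. *)
Definition cyc_window (V L : finType) (e0 : edge V L) (c : seq (edge V L)) i m :=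
  map (cyc_edge e0 c) (iota i m).

Lemma cyc_windowD (V L : finType) (e0 : edge V L) c i a b :
  cyc_window e0 c i (a + b) = cyc_window e0 c i a ++ cyc_window e0 c (i + a) b.
Proof. by rewrite /cyc_window iotaD map_cat. Qed.

Lemma cyc_window_mod (V L : finType) (e0 : edge V L) c i m :
  cyc_window e0 c (i %% size c)%N m = cyc_window e0 c i m.
Proof.
rewrite /cyc_window -(addn0 (i %% _)%N) -[in RHS](addn0 i) !iotaDl -!map_comp.
by apply: eq_map => k /=; rewrite /cyc_edge modnDml.
Qed.

Lemma cyc_window_full (V L : finType) (e0 : edge V L) c :
  cyc_window e0 c 0 (size c) = c.
Proof.
rewrite -[RHS](mkseq_nth e0) /cyc_window /mkseq; apply/eq_in_map => i.
by rewrite mem_iota /cyc_edge => /andP[_ ic]; rewrite modn_small.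
Qed.

Lemma cyc_edge_step (V L : finType) (E : {set edge V L}) e0 c i :
  is_cycle E c -> dst (cyc_edge e0 c i) = src (cyc_edge e0 c i.+1).
Proof.
move=> [/and3P[cN0 _ ch] sd].
have c0 : (0 < size c)%N by case: c cN0 {ch sd}.
have step k : (k.+1 < size c)%N -> dst (nth e0 c k) = src (nth e0 c k.+1).
  elim: c k ch {cN0 c0 sd} => [|a [|b c] IH] [|k] //= /andP[/eqP ab ch] //.
  by move=> kc; rewrite (IH k ch).
(* At the last index the successor wraps to 0, where the closing condition of the cycle replaces
   chaining. *)
rewrite /cyc_edge; have := ltn_pmod i c0; rewrite leq_eqVlt => /orP[/eqP ic|ic].
  have -> : (i.+1 %% size c = 0)%N by rewrite -addn1 -modnDml addn1 ic modnn.
  move: sd; case: c ic {cN0 ch c0 step} => //= a c ic [->].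
  by case: ic => ->; congr dst; exact: (nth_last e0 (a :: c)).
by rewrite -[in RHS]addn1 -[in RHS]modnDml addn1 (modn_small ic) step.
Qed.

Lemma cyc_window_path (V L : finType) (E : {set edge V L}) e0 c i m :
  is_cycle E c -> (0 < m)%N -> is_path E (cyc_window e0 c i m).
Proof.
move=> cc; case: m => // m _; have [/and3P[cN0 /allP call _] _] := cc.
have c0 : (0 < size c)%N by case: c cN0 {cc call}.
apply/and3P; split=> //.
  apply/allP => e /mapP[k _ ->]; apply: call.
  by rewrite /cyc_edge mem_nth// ltn_pmod.
elim: m i => [//|m IH] i.
by apply/andP; split; [rewrite (cyc_edge_step _ _ cc)|exact: IH].
Qed.

Lemma cyc_window_src (V L : finType) (e0 : edge V L) c i m : (0 < m)%N ->
  path_src (cyc_window e0 c i m) = Some (src (cyc_edge e0 c i)).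
Proof. by case: m. Qed.

Lemma cyc_window_dst (V L : finType) (E : {set edge V L}) e0 c i m :
  is_cycle E c -> (0 < m)%N ->
  path_dst (cyc_window e0 c i m) = Some (src (cyc_edge e0 c (i + m))).
Proof.
move=> cc; case: m => // m _; rewrite /= addnS -(cyc_edge_step _ _ cc).
elim: m i => [|m IH] i /=; first by rewrite addn0.
by rewrite addnS -addSn -IH.
Qed.

(** Links windows to the rotations in [simple_cycle]. *)
Lemma cyc_window_rot (V L : finType) (e0 : edge V L) c k :
  (k <= size c)%N -> cyc_window e0 c k (size c) = rot k c.
Proof.
move=> kc; have wk : size (cyc_window e0 c 0 k) = k by rewrite size_map size_iota.
rewrite -[in RHS](cyc_window_full e0 c) -[in RHS](subnKC kc) cyc_windowD add0n.
rewrite -{2}wk rot_size_cat -[in LHS](subnK kc) cyc_windowD subnKC//; congr cat.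
by rewrite -cyc_window_mod modnn.
Qed.

Lemma cyc_edge_modD (V L : finType) (e0 : edge V L) c i :
  cyc_edge e0 c (i + size c) = cyc_edge e0 c i.
Proof. by rewrite /cyc_edge modnDr. Qed.

(* Rotating a cycle to a repeated node splits it into two cycles there. *)
Lemma simple_cycle_uniq_src (V L : finType) (E : {set edge V L}) c :
  simple_cycle E c -> uniq (map (@src V L) c).
Proof.
move=> [cc simple]; have [/and3P[cN0 _ _] _] := cc.
have [e0 _] : exists e0, e0 \in c.
  by case: c cN0 {cc simple} => // e c; exists e; rewrite mem_head.
apply: contraT => /(uniqPn (src e0))[i [j []]]; rewrite size_map => ij jc.
have ic : (i < size c)%N by exact: ltn_trans jc.
rewrite !(nth_map e0)// => eqij.
have Ei : cyc_edge e0 c i = nth e0 c i by rewrite /cyc_edge modn_small.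
have Ej : cyc_edge e0 c j = nth e0 c j by rewrite /cyc_edge modn_small.
have m0 : (0 < j - i)%N by rewrite subn_gt0.
have m1 : (0 < size c - (j - i))%N by lia.
case: (simple (src (nth e0 c i))); first by rewrite map_f ?mem_nth.
exists i, (cyc_window e0 c i (j - i)), (cyc_window e0 c j (size c - (j - i))).
split.
  rewrite -(cyc_window_rot e0 (ltnW ic)) -{1}(subnKC (_ : j - i <= size c)%N).
    by rewrite cyc_windowD subnKC// ltnW.
  by lia.
(* The second window ends one full period after index i, hence at the same node. *)
have jE : (j + (size c - (j - i)) = i + size c)%N by lia.
split; split; rewrite ?cyc_window_src// ?Ei// ?Ej ?eqij//; split.
- exact: cyc_window_path.
- by rewrite cyc_window_src// (cyc_window_dst _ _ cc)// subnKC ?Ei ?Ej ?eqij// ltnW.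
- exact: cyc_window_path.
- by rewrite cyc_window_src// (cyc_window_dst _ _ cc)// jE cyc_edge_modD Ei Ej eqij.
Qed.

(** * Strict feasibility and the cycle *)

Lemma gamma_star_ge0 (R : realType) (n : nat) (V L : finType)
  (E : {set edge V L}) (A : L -> 'M[R]_n) : 0 <= gamma_star E A.
Proof.
rewrite /gamma_star; set S := (X in inf X).
(* The infimum of the empty set is 0 by convention. *)
have [->|/set0P S0] := eqVneq S set0; first by rewrite inf0.
by apply: lb_le_inf => // g [].
Qed.

Lemma gamma_star_le (R : realType) (n : nat) (V L : finType)
  (E : {set edge V L}) (A : L -> 'M[R]_n) (Q : V -> 'M[R]_n) g :
  0 <= g -> (forall v, posdef (Q v)) ->
  (forall e, e \in E -> psd (lmi_mx A Q g e)) -> gamma_star E A <= g.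
Proof.
move=> g0 pQ hQ; apply: ge_inf; first by exists 0 => x /= [].
by split=> //; exists Q.
Qed.

Lemma lmi_mx_sym (R : realType) (n : nat) (V L : finType) (A : L -> 'M[R]_n)
  (Q : V -> 'M[R]_n) g (e : edge V L) :
  (forall v, (Q v)^T = Q v) -> (lmi_mx A Q g e)^T = lmi_mx A Q g e.
Proof.
by move=> h; rewrite /lmi_mx linearB /= linearZ /= !trmx_mul trmxK !h mulmxA.
Qed.

Lemma lmi_mx_comb (R : realType) (n : nat) (V L : finType) (A : L -> 'M[R]_n)
  (Q P : V -> 'M[R]_n) D g (e : edge V L) x :
  qform (lmi_mx A (fun v => D *: Q v + P v) g e) x =
  D * qform (lmi_mx A Q g e) x + qform (lmi_mx A P g e) x.
Proof.
rewrite /lmi_mx !(qformD, qformN, qformZ, qform_congr); ring.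
Qed.

(* Strict inequalities on finitely many edges leave room to lower [g]:
   [g^2] may be replaced by [g^2 - 1/D] for a large [D]. *)
Lemma gamma_star_lt_strict (R : realType) (n : nat) (V L : finType)
  (E : {set edge V L}) (A : L -> 'M[R]_n) (Q : V -> 'M[R]_n) g :
  0 < g -> (forall v, posdef (Q v)) ->
  (forall e, e \in E -> posdef (lmi_mx A Q g e)) -> gamma_star E A < g.
Proof.
move=> g0 pQ hQ.
have : forall e : edge V L, exists C, forall D, C <= D -> e \in E ->
    forall x, qform (Q (src e)) x <= D * qform (lmi_mx A Q g e) x.
  move=> e; have [eE|_] := boolP (e \in E); last by exists 0.
  have [C hC] := posdef_dominates (Q (src e)) (hQ e eE).
  by exists C => D CD _ x; exact: hC.
move=> /fin_uniform_bound[C hC].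
(* The second term ensures 1/D <= g^2, so that g^2 - 1/D has a real square root. *)
pose D := `|C| + (g ^+ 2)^-1.
have gg0 : 0 < g ^+ 2 by rewrite exprn_gt0.
have D0 : 0 < D by rewrite ltr_wpDl// invr_gt0.
have CD : C <= D by rewrite ler_wpDr ?invr_ge0 ?(ltW gg0)// ler_norm.
have r0 : 0 <= g ^+ 2 - D^-1.
  by rewrite subr_ge0 invf_ple ?posrE// lerDr.
apply: (@le_lt_trans _ _ (Num.sqrt (g ^+ 2 - D^-1))); last first.
  by rewrite -[ltRHS](ger0_norm (ltW g0)) -sqrtr_sqr ltr_sqrt// ltrBlDr ltrDl invr_gt0.
apply: (gamma_star_le (Q := Q)) => [|//|e eE]; first exact: sqrtr_ge0.
split; first by apply: lmi_mx_sym => v; case: (pQ v).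
move=> x; have := hC D CD e eE x; rewrite -/(qform _ x) /lmi_mx.
rewrite sqr_sqrtr// !(qformD, qformN, qformZ, qform_congr).
move: (qform _ x) (qform _ (_ *m x)) => a b h.
rewrite mulrBl -(pmulr_rge0 _ D0).
have -> : D * (g ^+ 2 * a - D^-1 * a - b) = D * (g ^+ 2 * a - b) - a.
  by field; rewrite gt_eqF.
by rewrite subr_ge0.
Qed.

(** * Products along the cycle and their Lyapunov sums *)

Definition cyc_prod (R : realType) (n : nat) (V L : finType) (A : L -> 'M[R]_n)
  (e0 : edge V L) c i m := prodA A (map (@lab V L) (cyc_window e0 c i m)).

Lemma cyc_prod0 (R : realType) (n : nat) (V L : finType) (A : L -> 'M[R]_n)
  (e0 : edge V L) c i : cyc_prod A e0 c i 0 = 1%:M.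
Proof. by []. Qed.

Lemma cyc_prodS (R : realType) (n : nat) (V L : finType) (A : L -> 'M[R]_n)
  (e0 : edge V L) c i m : cyc_prod A e0 c i m.+1 =
  cyc_prod A e0 c i.+1 m *m A (lab (cyc_edge e0 c i)).
Proof. exact: prodA_cons. Qed.

Lemma cyc_prodD (R : realType) (n : nat) (V L : finType) (A : L -> 'M[R]_n)
  (e0 : edge V L) c i a b : cyc_prod A e0 c i (a + b) =
  cyc_prod A e0 c (i + a) b *m cyc_prod A e0 c i a.
Proof. by rewrite /cyc_prod cyc_windowD map_cat prodA_cat. Qed.

Lemma cyc_prod_mod (R : realType) (n : nat) (V L : finType) (A : L -> 'M[R]_n)
  (e0 : edge V L) c i m : cyc_prod A e0 c (i %% size c)%N m = cyc_prod A e0 c i m.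
Proof. by rewrite /cyc_prod cyc_window_mod. Qed.

(* Truncated Lyapunov series of the cycle: on an edge of the cycle it
   telescopes to [g^2 (1 - g^(-2N) M^T M)] with [M] the product of length [N]. *)
Definition cyc_lyapunov (R : realType) (n : nat) (V L : finType)
  (A : L -> 'M[R]_n) (e0 : edge V L) c (g : R) N i : 'M[R]_n :=
  \sum_(m < N) (g ^+ 2) ^- m *: ((cyc_prod A e0 c i m)^T *m cyc_prod A e0 c i m).

Lemma qform_cyc_lyapunov (R : realType) (n : nat) (V L : finType)
  (A : L -> 'M[R]_n) (e0 : edge V L) c (g : R) N i x :
  qform (cyc_lyapunov A e0 c g N i) x =
  \sum_(m < N) (g ^+ 2) ^- m * qform 1%:M (cyc_prod A e0 c i m *m x).
Proof.
rewrite /cyc_lyapunov; elim: N => [|N IH].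
  by rewrite !big_ord0 /qform mulmx0 mul0mx mxE.
rewrite !big_ord_recr /= qformD IH qformZ; congr (_ + _ * _).
by rewrite -qform_congr mulmx1.
Qed.

(** Since M_(i,m+1) = M_(i+1,m) A_i, term m of the sum at i+1 is g^2 times term m+1 of the sum at i;
    only the two end terms survive. *)
Lemma cyc_lyapunov_edge (R : realType) (n : nat) (V L : finType)
  (A : L -> 'M[R]_n) (e0 : edge V L) c (g : R) N i x :
  g != 0 ->
  g ^+ 2 * qform (cyc_lyapunov A e0 c g N i) x -
  qform (cyc_lyapunov A e0 c g N i.+1) (A (lab (cyc_edge e0 c i)) *m x) =
  g ^+ 2 * (qform 1%:M x -
            (g ^+ 2) ^- N * qform 1%:M (cyc_prod A e0 c i N *m x)).
Proof.
move=> g0; rewrite !qform_cyc_lyapunov; have gg0 : g ^+ 2 != 0 by rewrite expf_neq0.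
move: (g ^+ 2) gg0 => h h0.
elim: N => [|N IH].
  by rewrite !big_ord0 expr0 invr1 mul1r cyc_prod0 mul1mx subrr !mulr0 subrr.
rewrite !big_ord_recr /= mulrDr opprD addrACA IH cyc_prodS -mulmxA exprS.
by field; rewrite h0 /= expf_neq0.
Qed.

(** The minimality of [gamma_star] enters here: contraction of all products of length N would yield
    a strictly feasible family at [gamma_star] itself. *)
Lemma cyc_growth_not_contracting (R : realType) (n : nat) (V L : finType)
  (E : {set edge V L}) (A : L -> 'M[R]_n) (Q : V -> 'M[R]_n) e0 c N :
  (forall v, posdef (Q v)) ->
  (forall e, e \in E -> psd (lmi_mx A Q (gamma_star E A) e)) ->
  (forall e, e \in E -> e \notin c -> posdef (lmi_mx A Q (gamma_star E A) e)) ->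
  is_cycle E c -> uniq (map (@src V L) c) ->
  0 < gamma_star E A ->
  exists i (x : 'cV[R]_n), x != 0 /\
    gamma_star E A ^+ 2 ^+ N * qform 1%:M x <=
    qform 1%:M (cyc_prod A e0 c i N *m x).
Proof.
move=> pQ hQ hE cc uc g0; set g := gamma_star E A in hQ hE g0 *.
apply: contrapT => nex.
have lt_qf i (x : 'cV[R]_n) : x != 0 ->
    qform 1%:M (cyc_prod A e0 c i N *m x) < g ^+ 2 ^+ N * qform 1%:M x.
  move=> xN0; rewrite ltNge; apply/negP => h; apply: nex.
  by exists i, x; split.
have [/and3P[cN0 /allP cE _] _] := cc.
have c0 : (0 < size c)%N by case: (c) cN0.
(* A node off the cycle gets index [size c]; its [P v] is still positive semidefinite. *)
pose P v := cyc_lyapunov A e0 c g N (index v (map (@src V L) c)).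
have P_sym v : (P v)^T = P v.
  rewrite /P /cyc_lyapunov linear_sum; apply: eq_bigr => m _.
  by rewrite linearZ /= trmx_mul trmxK.
have P_ge0 v x : 0 <= qform (P v) x.
  rewrite qform_cyc_lyapunov sumr_ge0// => m _.
  have [_ I0] := posdef_psd (posdef1 R n).
  apply: mulr_ge0; last exact: I0.
  by rewrite invr_ge0 !exprn_ge0// ltW.
have P_edge e x : e \in c -> x != 0 -> 0 < qform (lmi_mx A P g e) x.
  move=> ec xN0; pose i := index e c.
  have ic : (i < size c)%N by rewrite index_mem.
  have ei : e = cyc_edge e0 c i by rewrite /cyc_edge modn_small// nth_index.
  (* As sources are distinct, the node at position k has index k modulo the period, on which alone
     the products depend. *)
  have idx k : cyc_lyapunov A e0 c g N (index (src (cyc_edge e0 c k)) (map (@src V L) c))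
      = cyc_lyapunov A e0 c g N k.
    have -> : src (cyc_edge e0 c k) = nth (src e0) (map (@src V L) c) (k %% size c)%N.
      by rewrite (nth_map e0)// ltn_pmod.
    rewrite index_uniq ?size_map ?ltn_pmod//; apply: eq_bigr => m _.
    by rewrite cyc_prod_mod.
  rewrite /lmi_mx qformD qformN qformZ qform_congr /P ei.
  rewrite (cyc_edge_step _ _ cc) !idx cyc_lyapunov_edge ?gt_eqF//.
  rewrite mulr_gt0 ?exprn_gt0// subr_gt0 mulrC ltr_pdivrMr ?exprn_gt0//.
  by rewrite mulrC; exact: lt_qf.
have : forall e : edge V L, exists C, forall D, C <= D -> e \in E -> e \notin c ->
    forall x, qform (- lmi_mx A P g e) x <= D * qform (lmi_mx A Q g e) x.
  move=> e; have [/andP[eE ec]|h] := boolP ((e \in E) && (e \notin c)).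
    have [C hC] := posdef_dominates (- lmi_mx A P g e) (hE e eE ec).
    by exists C => D CD _ _ x; exact: hC.
  by exists 0 => D _ eE ec; rewrite eE ec in h.
move=> /fin_uniform_bound[C hC].
(* Off the cycle, |C| copies of the [Q] form absorb the [P] form and the remaining copy is strictly
   positive. On the cycle, strictness comes from [P]. *)
pose D := `|C| + 1.
have D0 : 0 < D by rewrite ltr_wpDl.
suff : gamma_star E A < g by rewrite ltxx.
apply: (gamma_star_lt_strict (Q := fun v => D *: Q v + P v)) => // [v|e eE].
  split; first by rewrite linearD linearZ /= P_sym; case: (pQ v) => ->.
  move=> x xN0; rewrite -/(qform _ x) qformD qformZ.
  by rewrite ltr_wpDr// mulr_gt0//; case: (pQ v) => _; exact.
split.
  apply: lmi_mx_sym => v.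
  by rewrite linearD linearZ /= P_sym; case: (pQ v) => ->.
move=> x xN0; rewrite -/(qform _ x) lmi_mx_comb.
have [ec|ec] := boolP (e \in c).
  rewrite ltr_wpDl// ?P_edge// mulr_ge0// ?(ltW D0)//.
  by case: (hQ e eE) => _; exact.
have := hC `|C| (ler_norm _) e eE ec x; rewrite qformN.
have : 0 < qform (lmi_mx A Q g e) x by case: (hE e eE ec) => _; exact.
rewrite /D; lra.
Qed.

(** * Growth rates *)

(** Squaring the norm inequality gives the matrix inequality, so for this [Q] both have the same
    admissible g, of which [gamma_star] is the least. *)
Lemma multinorm_value_quadnorm (R : realType) (n : nat) (V L : finType)
  (E : {set edge V L}) (A : L -> 'M[R]_n) (Q : V -> 'M[R]_n) :
  0 <= gamma_star E A -> (forall v, posdef (Q v)) ->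
  (forall e, e \in E -> psd (lmi_mx A Q (gamma_star E A) e)) ->
  multinorm_value E A (quadnorm Q) = gamma_star E A.
Proof.
move=> g0 pQ hQ; have Q0 v x : 0 <= qform (Q v) x.
  by have [_] := posdef_psd (pQ v); exact.
have feasible g : 0 <= g ->
    (forall e, e \in E -> forall x,
       quadnorm Q (dst e) (A (lab e) *m x) <= g * quadnorm Q (src e) x) <->
    (forall e, e \in E -> psd (lmi_mx A Q g e)).
  move=> gge0.
  have N0 v x : 0 <= quadnorm Q v x by exact: sqrtr_ge0.
  have NE v x : quadnorm Q v x ^+ 2 = qform (Q v) x by rewrite sqr_sqrtr ?Q0.
  have qE e x : (quadnorm Q (dst e) (A (lab e) *m x) <= g * quadnorm Q (src e) x)
      = (0 <= qform (lmi_mx A Q g e) x).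
    rewrite /lmi_mx qformD qformN qformZ qform_congr subr_ge0.
    by rewrite -[LHS](@ler_pXn2r _ 2)// ?nnegrE ?mulr_ge0// exprMn !NE.
  split=> [h e eE|h e eE x]; last by rewrite qE; have [_] := h e eE; exact.
  split=> [|x]; last by rewrite -/(qform _ x) -qE; exact: h.
  by apply: lmi_mx_sym => v; case: (pQ v).
apply/le_anti/andP; split.
  apply: ge_inf; first by exists 0 => x /= [].
  by split=> //; apply/feasible.
apply: lb_le_inf; first by exists (gamma_star E A); split=> //; apply/feasible.
move=> g [gge0 /(feasible _ gge0) hg]; exact: (gamma_star_le (Q := Q)).
Qed.

(** Entry (i, j) of a product is a coordinate of its image of the j-th basis vector: [C2] bounds the
    form of that vector at the source, [C1] the coordinate by the form at the target. *)
Lemma path_norm_bound (R : realType) (n : nat) (V L : finType)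
  (E : {set edge V L}) (A : L -> 'M[R]_n) (Q : V -> 'M[R]_n) g :
  0 <= g -> (forall v, posdef (Q v)) ->
  (forall e, e \in E -> psd (lmi_mx A Q g e)) ->
  exists2 K, 1 <= K & forall p, is_path E p ->
    `|prodA A (map (@lab V L) p)| <= K * g ^+ size p.
Proof.
move=> g0 pQ hQ.
have : forall v, exists C, forall D, C <= D ->
    forall x, qform 1%:M x <= D * qform (Q v) x.
  by move=> v; exact: posdef_dominates.
move=> /fin_uniform_bound[C1 hC1].
have : forall vj : V * 'I_n, exists C, forall D, C <= D ->
    qform (Q vj.1) (delta_mx vj.2 0) <= D.
  by move=> vj; exists (qform (Q vj.1) (delta_mx vj.2 0)).
move=> /fin_uniform_bound[C2 hC2].
(* The summand 1 makes K >= 1, so that K also bounds the empty product. *)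
exists (1 + Num.sqrt (`|C1| * `|C2|)); first by rewrite lerDl sqrtr_ge0.
move=> [|e p] // hp; apply: mx_norm_le => [|i j].
  by rewrite mulr_ge0 ?exprn_ge0// addr_ge0// sqrtr_ge0.
apply: (@le_trans _ _ (Num.sqrt (`|C1| * `|C2|) * g ^+ (size p).+1)); last first.
  by rewrite ler_wpM2r ?exprn_ge0// lerDr.
set M := prodA _ _; pose x : 'cV[R]_n := delta_mx j 0.
rewrite -(@ler_pXn2r _ 2)// ?nnegrE// ?mulr_ge0 ?exprn_ge0 ?sqrtr_ge0//.
rewrite real_normK ?num_real// exprMn sqr_sqrtr; last by rewrite mulr_ge0.
have -> : M i j = (M *m x) i 0 by rewrite -colE mxE.
apply: le_trans (qform1_coord _ _) _.
apply: le_trans (hC1 _ (ler_norm C1) (dst (last e p)) _) _.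
rewrite -mulrA ler_wpM2l//; apply: le_trans (path_qform_bound hQ hp x) _.
rewrite exprAC mulrC ler_wpM2r ?exprn_ge0//.
exact: (hC2 _ (ler_norm C2) (src e, j)).
Qed.

Lemma qform1_mulmx_le (R : realType) (n : nat) (M : 'M[R]_n) x :
  qform 1%:M (M *m x) <= (n%:R ^+ 2 * `|M|) ^+ 2 * qform 1%:M x.
Proof.
rewrite -qform_congr mulmx1; apply: le_trans (qform_le_norm _ _) _.
have q0 : 0 <= qform 1%:M x by have [_] := posdef_psd (posdef1 R n); exact.
apply: ler_wpM2r => //.
have trM : `|M^T| <= `|M|.
  by apply: mx_norm_le => // i j; rewrite mxE mx_norm_entry.
have entry i j : `|(M^T *m M) i j| <= n%:R * (`|M| * `|M|).
  apply: le_trans (mx_norm_entry _ _ _) _; apply: le_trans (mx_norm_mulmx _ _) _.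
  by rewrite ler_wpM2l// ler_wpM2r.
apply: (@le_trans _ _ (\sum_(i < n) \sum_(j < n) n%:R * (`|M| * `|M|))).
  by apply: ler_sum => i _; apply: ler_sum => j _; exact: entry.
rewrite !sumr_const card_ord -mulrnA -[leLHS]mulr_natl natrM.
(* The factor n^3 is rounded up to n^4 to get a perfect square. *)
have -> : n%:R * n%:R * (n%:R * (`|M| * `|M|)) = n%:R ^+ 3 * `|M| ^+ 2 :> R by ring.
have -> : (n%:R ^+ 2 * `|M|) ^+ 2 = n%:R ^+ 4 * `|M| ^+ 2 by ring.
rewrite ler_wpM2r ?sqr_ge0//.
case: n {M x q0 trM entry} => [|n]; first by rewrite !expr0n.
by rewrite ler_weXn2l// ler1n.
Qed.

Lemma cyc_growth (R : realType) (n : nat) (V L : finType)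
  (E : {set edge V L}) (A : L -> 'M[R]_n) (Q : V -> 'M[R]_n) e0 c N :
  0 <= gamma_star E A -> (forall v, posdef (Q v)) ->
  (forall e, e \in E -> psd (lmi_mx A Q (gamma_star E A) e)) ->
  (forall e, e \in E -> e \notin c -> posdef (lmi_mx A Q (gamma_star E A) e)) ->
  is_cycle E c -> uniq (map (@src V L) c) -> (0 < N)%N ->
  exists i, gamma_star E A ^+ N <= n%:R ^+ 2 * `|cyc_prod A e0 c i N|.
Proof.
move=> g0 pQ hQ hE cc uc N0; have [gE|gN0] := eqVneq (gamma_star E A) 0.
  by exists 0; rewrite gE expr0n eqn0Ngt N0 mulr_ge0// exprn_ge0.
have g_gt0 : 0 < gamma_star E A by rewrite lt_neqAle eq_sym gN0.
have [i [x [xN0 hx]]] := cyc_growth_not_contracting e0 N pQ hQ hE cc uc g_gt0.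
exists i; have := le_trans hx (qform1_mulmx_le _ _).
by rewrite ler_pM2r ?qform1_gt0// exprAC ler_pXn2r// nnegrE ?exprn_ge0//.
Qed.

Lemma cvg_root (R : realType) (K : R) :
  0 < K -> (K `^ (t%:R^-1) @[t --> \oo] --> (1 : R))%classic.
Proof.
move=> K0; rewrite [X in (_ --> X)%classic](_ : (1 : R) = expR (0 * ln K)); last first.
  by rewrite mul0r expR0.
have -> : (fun t : nat => K `^ (t%:R^-1)) = expR \o (fun t : nat => t%:R^-1 * ln K).
  by apply/funext => t /=; rewrite /powR gt_eqF.
have lim0 : ((t%:R^-1 : R) * ln K @[t --> \oo] --> 0 * ln K)%classic.
  apply: cvgMl; rewrite -(cvg_shiftS (fun t : nat => t%:R^-1 : R)).
  exact: cvg_harmonic.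
exact: (@continuous_cvg _ _ _ _ _ _ _ _ (@continuous_expR R (0 * ln K)) lim0).
Qed.

Lemma rootK (R : realType) (x : R) t :
  0 <= x -> (0 < t)%N -> (x ^+ t) `^ (t%:R^-1) = x.
Proof.
move=> x0 t0; rewrite -powR_mulrn// -powRrM mulfV ?pnatr_eq0 -?lt0n//.
exact: powRr1.
Qed.

(** The t-th term lies between k^(1/t) g and K^(1/t) g, and both roots tend to 1. *)
Lemma cjsr_eq (R : realType) (n : nat) (V L : finType) (E : {set edge V L})
  (A : L -> 'M[R]_n) g k K :
  0 <= g -> 0 < k -> 0 < K ->
  (forall p, is_path E p ->
    `|prodA A (map (@lab V L) p)| <= K * g ^+ size p) ->
  (forall t, (0 < t)%N -> exists2 p, is_path E p & size p = t /\
    k * g ^+ t <= `|prodA A (map (@lab V L) p)|) ->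
  cjsr E A = g.
Proof.
move=> g0 k0 K0 ub lb; rewrite /cjsr.
have scale (C : R) t : (0 < t)%N -> 0 <= C ->
    (C * g ^+ t) `^ (t%:R^-1) = C `^ (t%:R^-1) * g.
  by move=> t0 C0; rewrite powRM ?exprn_ge0// rootK.
apply: cvg_lim => //.
have cvg_scaled (C : R) : 0 < C -> (C `^ (t%:R^-1) * g @[t --> \oo] --> g)%classic.
  by move=> C0; rewrite -[X in (_ --> X)%classic]mul1r; apply: cvgMl; exact: cvg_root.
apply: (squeeze_cvgr _ (cvg_scaled k k0) (cvg_scaled K K0)).
exists 1%N => // t /= t0.
have [p hp [sp hkp]] := lb t t0.
have bounded : ubound [set `|prodA A s| `^ (t%:R^-1) | s in
    [set s | accepted E s /\ size s = t]]%classic (K `^ (t%:R^-1) * g).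
  move=> _ /= [s [[q [hq <-]] sq] <-]; rewrite size_map in sq.
  rewrite -(scale _ _ t0 (ltW K0)) ge0_ler_powR ?nnegrE ?invr_ge0//.
    by rewrite mulr_ge0 ?exprn_ge0// ltW.
  by rewrite -sq; exact: ub.
have mem : [set `|prodA A s| `^ (t%:R^-1) | s in
    [set s | accepted E s /\ size s = t]]%classic
    (`|prodA A (map (@lab V L) p)| `^ (t%:R^-1)).
  exists (map (@lab V L) p) => //=; rewrite size_map; split=> //; by exists p.
apply/andP; split.
  apply: le_trans (ub_le_sup _ mem); last by eexists; exact: bounded.
  rewrite -(scale _ _ t0 (ltW k0)) ge0_ler_powR ?nnegrE ?invr_ge0//.
  by rewrite mulr_ge0 ?exprn_ge0// ltW.
by apply: ge_sup => //; exists (`|prodA A (map (@lab V L) p)| `^ (t%:R^-1)).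
Qed.

(** * The spectral radius of the cycle product *)

Lemma spectral_radius_ub (R : realType) (n : nat) (M : 'M[R]_n) r :
  0 <= r ->
  (forall l, eigenvalue (map_mx (real_complex R) M) l -> Normc.normc l <= r) ->
  spectral_radius M <= r.
Proof.
move=> r0 h; rewrite /spectral_radius; set S := (X in sup X).
(* An empty spectrum has supremum 0 by convention, whence the assumption on r. *)
have [->|/set0P SN0] := eqVneq S set0; first by rewrite sup0.
apply: ge_sup => // _ [l /= ev <-]; rewrite normc_sqrt; exact: h.
Qed.

Lemma eigenvalue_le_spectral_radius (R : realType) (n : nat) (M : 'M[R]_n) r l :
  (forall l, eigenvalue (map_mx (real_complex R) M) l -> Normc.normc l <= r) ->
  eigenvalue (map_mx (real_complex R) M) l ->
  Normc.normc l <= spectral_radius M.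
Proof.
move=> h ev; apply: ub_le_sup; last by exists l => //; rewrite normc_sqrt.
by exists r => _ [z /= evz <-]; rewrite normc_sqrt; exact: h.
Qed.

Lemma cyc_prod_norm_bound (R : realType) (n : nat) (V L : finType)
  (E : {set edge V L}) (A : L -> 'M[R]_n) e0 c K g i m :
  is_cycle E c -> 1 <= K ->
  (forall p, is_path E p ->
    `|prodA A (map (@lab V L) p)| <= K * g ^+ size p) ->
  `|cyc_prod A e0 c i m| <= K * g ^+ m.
Proof.
move=> cc K1 hK; case: m => [|m].
  (* The empty window is not a path; K >= 1 covers it. *)
  rewrite cyc_prod0 expr0 mulr1; apply: le_trans K1.
  apply: mx_norm_le => // j k; rewrite mxE normr_nat.
  by case: eqP => _ //; rewrite ler01.
apply: le_trans (hK _ (cyc_window_path _ _ cc _)) _ => //.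
by rewrite size_map size_iota.
Qed.

Lemma cyc_prod_period (R : realType) (n : nat) (V L : finType)
  (A : L -> 'M[R]_n) (e0 : edge V L) c k :
  cyc_prod A e0 c 0 (size c * k) =
  iter k (mulmx (prodA A (map (@lab V L) c))) 1%:M.
Proof.
elim: k => [|k IH]; first by rewrite muln0.
rewrite iterS mulnSr cyc_prodD IH add0n -cyc_prod_mod modnMr /cyc_prod.
by rewrite cyc_window_full.
Qed.

Lemma iter_mulmx (R : pzRingType) (n : nat) (M : 'M[R]_n.+1) k :
  iter k (mulmx M) 1%:M = M ^+ k.
Proof. by elim: k => // k IH; rewrite iterS IH exprS. Qed.

Theorem theorem3p12 (R : realType) (n : nat) (V L : finType)
  (E : {set edge V L}) (A : L -> 'M[R]_n) (Q : V -> 'M[R]_n)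
  (c : seq (edge V L)) :
  strongly_connected E ->
  (forall v, posdef (Q v)) ->
  (forall e, e \in E -> psd (lmi_mx A Q (gamma_star E A) e)) ->
  simple_cycle E c ->
  [set e in E | lambda_min (lmi_mx A Q (gamma_star E A) e) == 0]
    = [set e | e \in c] ->
  extremal E A (quadnorm Q) /\
  cjsr E A = spectral_radius (prodA A (map (@lab V L) c)) `^ ((size c)%:R^-1).
Proof.
move=> _ pQ hQ sc eqE'; set Ac := prodA A _.
have uc := simple_cycle_uniq_src sc; have [cc _] := sc.
have [/and3P[cN0 _ _] _] := cc.
have [e0 _] : exists e0, e0 \in c.
  by case: (c) cN0 => // e q; exists e; rewrite mem_head.
have T0 : (0 < size c)%N by rewrite lt0n size_eq0.
have hE e : e \in E -> e \notin c -> posdef (lmi_mx A Q (gamma_star E A) e).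
  move=> eE ec; apply: psd_posdef; first exact: hQ.
  apply: contra ec => l0; have : e \in [set e | e \in c].
    by rewrite -eqE' !inE eE.
  by rewrite inE.
have g0 : 0 <= gamma_star E A by exact: gamma_star_ge0.
have Hg N : (0 < N)%N -> exists i,
    gamma_star E A ^+ N <= n%:R ^+ 2 * `|cyc_prod A e0 c i N|.
  by move=> N0; exact: (cyc_growth e0 g0 pQ hQ hE cc uc N0).
have [K K1 hK] := path_norm_bound g0 pQ hQ.
have K0 : 0 < K by exact: lt_le_trans K1.
have cjsrE : cjsr E A = gamma_star E A.
  (* Adding 1 keeps the constant invertible for n = 0. *)
  have nn0 : 0 < (1 + n%:R ^+ 2 : R) by rewrite ltr_wpDr// exprn_ge0.
  apply: (cjsr_eq (k := (1 + n%:R ^+ 2)^-1) (K := K)) => //.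
  move=> t t0; have [i hi] := Hg t t0.
  exists (cyc_window e0 c i t); first exact: cyc_window_path.
  split; first by rewrite size_map size_iota.
  rewrite mulrC ler_pdivrMr// mulrC; apply: le_trans hi _.
  by rewrite mulrDl mul1r lerDr.
split; first by rewrite /extremal cjsrE multinorm_value_quadnorm.
move: (gamma_star E A) g0 Hg hK cjsrE => g g0 Hg hK cjsrE.
rewrite {}cjsrE.
suff -> : spectral_radius Ac = g ^+ size c by rewrite rootK.
(* Powers of [Ac] are products over whole periods, hence bounded by K g^(T k). *)
have ev_le l : eigenvalue (map_mx (real_complex R) Ac) l ->
    Normc.normc l <= g ^+ size c.
  apply: (eigenvalue_le_growth (C := K)) => [|k]; first exact: exprn_ge0.
  by rewrite -(cyc_prod_period A e0) -exprM; exact: (cyc_prod_norm_bound _ _ _ cc K1 hK).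
apply/le_anti/andP; split; first by apply: spectral_radius_ub; rewrite ?exprn_ge0.
have rho_ge l : eigenvalue (map_mx (real_complex R) Ac) l ->
    Normc.normc l <= spectral_radius Ac.
  by move=> evl; exact: (eigenvalue_le_spectral_radius ev_le evl).
case: n A Q @Ac pQ hQ eqE' hE Hg hK ev_le rho_ge =>
  [|n] A Q Ac pQ hQ eqE' hE Hg hK ev_le rho_ge.
  (* For n = 0 the spectrum is empty and its radius 0, while the growth bound forces g^T <= 0. *)
  have [i gT] := Hg _ T0; rewrite expr0n mul0r in gT.
  apply: le_trans gT _; rewrite /spectral_radius; set S := (X in sup X).
  have -> : S = set0.
    apply/seteqP; split=> // r [l /= /eigenvalueP[v _]].
    by rewrite thinmx0 eqxx.
  by rewrite sup0.
rewrite leNgt; apply/negP => rho_lt; set rho := spectral_radius Ac in rho_ge rho_lt.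
have [l ev] : exists l, eigenvalue (map_mx (real_complex R) Ac) l.
  have /closed_rootP[l hl] : size (char_poly (map_mx (real_complex R) Ac)) != 1%N.
    by rewrite size_char_poly.
  by exists l; rewrite eigenvalue_root_char.
have rho0 : 0 <= rho by exact: le_trans (normc_ge0 l) (rho_ge l ev).
(* If rho(A_c) < g^T, powers of [Ac] grow at most like s^k for this s strictly between, against the
   growth along the cycle. *)
pose s := (rho + g ^+ size c) / 2.
have rho_s : rho < s by rewrite /s; lra.
have s_g : s < g ^+ size c by rewrite /s; lra.
have s0 : 0 <= s by lra.
have gT0 : 0 < g ^+ size c by exact: le_lt_trans s_g.
have [C C0 hC] : exists2 C, 0 <= C & forall k, `|Ac ^+ k| <= C * s ^+ k.
  apply: eigenvalue_bound_power => // z evz.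
  exact: le_lt_trans (rho_ge z evz) rho_s.
have [B B0 hB] : exists2 B, 0 <= B &
    forall i m, (m <= size c)%N -> `|cyc_prod A e0 c i m| <= B.
  exists (K * (1 + g) ^+ size c).
    by rewrite mulr_ge0 ?exprn_ge0 ?addr_ge0// ltW.
  move=> i m mc; apply: le_trans (cyc_prod_norm_bound _ _ _ cc K1 hK) _.
  apply: ler_wpM2l; first exact: ltW.
  apply: (@le_trans _ _ ((1 + g) ^+ m)); last by rewrite ler_weXn2l// lerDl.
  by rewrite lerXn2r ?nnegrE ?addr_ge0// lerDr.
(* Each of the two matrix products below costs a factor n+1, each incomplete period a factor [B],
   and the k full periods give C s^k. *)
pose D := n.+1%:R ^+ 2 * (n.+1%:R * (B * (n.+1%:R * (C * B)))).
suff : g ^+ size c <= s by rewrite leNgt s_g.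
apply: (@geometric_domination _ _ _ (D / g ^+ size c)) => // [|k]; first exact: ltW.
rewrite mulrAC ler_pdivlMr// -exprSr -exprM.
have [|j] := Hg (size c * k.+1)%N; first by rewrite muln_gt0 T0.
rewrite -cyc_prod_mod; set i := (j %% _)%N => hj; apply: le_trans hj _.
have ic : (i <= size c)%N by rewrite ltnW// ltn_pmod.
(* A window of k+1 periods from i runs to the end of the cycle, around it k times, and then over its
   first i edges. The period so broken up explains the division by g^T above. *)
have -> : (size c * k.+1 = (size c - i) + (size c * k + i))%N.
  by rewrite mulnS addnA addnAC subnK.
rewrite cyc_prodD subnKC// -(cyc_prod_mod _ _ _ (size c)) modnn cyc_prodD add0n.
rewrite cyc_prod_period iter_mulmx -/Ac.
have -> : D * s ^+ k = n.+1%:R ^+ 2 *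
    (n.+1%:R * (n.+1%:R * (B * (C * s ^+ k)) * B)) by rewrite /D; ring.
rewrite ler_wpM2l ?exprn_ge0//.
apply: le_trans (mx_norm_mulmx _ _) _; rewrite ler_wpM2l//.
apply: ler_pM => //; last by rewrite hB// leq_subr.
apply: le_trans (mx_norm_mulmx _ _) _; rewrite ler_wpM2l//.
by apply: ler_pM => //; exact: hB.
Qed.
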